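(* Let $(\mathcal{Y},\mathcal{A},\mu)$ be a measure space, $(\mathcal{X},d_{\mathcal{X}})$ a metric space, $1<p,q<\infty$ with $1/p+1/q=1$, and $k:\mathcal{X}\times\mathcal{Y}\to\mathbb{K}$ a function such that the following holds. 1. For all $x\in\mathcal{X}$, the function $k(x,\cdot)$ is measurable. 2. For all $g\in L^q(\mathcal{Y},\mathcal{A},\mu,\mathbb{K})$ and all $x\in\mathcal{X}$, $k(x,\cdot)\cdot g\in L^1(\mathcal{Y},\mathcal{A},\mu,\mathbb{K})$. 3. There exist $\alpha\in\mathbb{R}_{>0}$ and $L_\alpha\in\mathcal{L}^p(\mathcal{Y},\mathcal{A},\mu,\mathbb{R}_{\geq0})$ such that for $\mu$-almost all $y\in\mathcal{Y}$, the function $k(\cdot,y)$ is $\alpha$-H\''older continuous with H\''older constant $L_\alpha(y)$. In this case, $$S_k:L^q(\mathcal{Y},\mathcal{A},\mu,\mathbb{K})\to\mathbb{K}^{\mathcal{X}},\quad (S_kg)(x)=\int_{\mathcal{Y}}k(x,y)g(y)\,\mathrm{d}\mu(y)$$ is a well-defined linear mapping, and for all $g\in L^q(\mathcal{Y},\mathcal{A},\mu,\mathbb{K})$, the function $f=S_kg$ is $\alpha$-H\''older continuous with H\''older constant $\|L_\alpha\|_{\mathcal{L}^p}\|g\|_{L^q}$.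
   Context: $\mathbb{K}$ denotes $\mathbb{R}$ or $\mathbb{C}$. $\mathcal{L}^p$ denotes the space of $p$-integrable measurable functions (with values in the indicated set), and $L^p$ the corresponding space of equivalence classes modulo $\mu$-almost everywhere equality. A function $f:\mathcal{X}\to\mathbb{K}$ is $\alpha$-H\''older continuous with H\''older constant $L\geq0$ if $|f(x)-f(x')|\leq L\,d_{\mathcal{X}}(x,x')^\alpha$ for all $x,x'\in\mathcal{X}$. *)

(* Defs.v *)
From HB Require Import structures.
From mathcomp Require Import all_boot all_order all_algebra.
From mathcomp Require Import all_classical all_reals all_analysis.
From mathcomp Require Import measurable_realfun complex ring lra.
Import Order.TTheory GRing.Theory Num.Theory.
Import numFieldNormedType.Exports.

Set Implicit Arguments.
Unset Strict Implicit.
Unset Printing Implicit Defensive.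

Local Open Scope classical_set_scope.
Local Open Scope ring_scope.

Variant scalars := Reals | Complexes.

Definition scalar_field (R : realType) (s : scalars) : numFieldType :=
  match s with Reals => R | Complexes => R[i] end.

Definition scalar_re (R : realType) (s : scalars) : scalar_field R s -> R :=
  match s with Reals => id | Complexes => @complex.Re R end.

Definition scalar_im (R : realType) (s : scalars) : scalar_field R s -> R :=
  match s with Reals => fun=> 0 | Complexes => @complex.Im R end.

(* The norm `|z| of z : R[i] lives in R[i]; this is the R-valued modulus. *)
Definition scalar_abs (R : realType) (s : scalars) : scalar_field R s -> R :=
  match s with Reals => @Num.norm R R | Complexes => @Normc.normc R end.

Definition borel (K : numFieldType) := g_sigma_algebraType (@open K).
HB.instance Definition _ (K : numFieldType) := Measurable.on (borel K).

Definition scalar_integral (R : realType) (s : scalars) d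
    (Y : measurableType d) (mu : {measure set Y -> \bar R}) :
    (Y -> scalar_field R s) -> scalar_field R s :=
  match s with
  | Reals => fun f => Rintegral mu setT f
  | Complexes => fun f =>
      Complex (Rintegral mu setT (fun y => complex.Re (f y)))
              (Rintegral mu setT (fun y => complex.Im (f y)))
  end.

Section ScalarTheory.
Variables (R : realType) (s : scalars).
Local Notation K := (scalar_field R s).
Implicit Types x y : K.

Lemma scalar_abs_ge0 x : 0 <= scalar_abs x.
Proof. by case: s x => [x|[a b]] /=; rewrite ?normr_ge0 ?sqrtr_ge0. Qed.

Lemma scalar_abs0 : scalar_abs (0 : K) = 0.
Proof. by case: s => /=; [exact: normr0|exact: Normc.normc0]. Qed.

Lemma scalar_absM x y : scalar_abs (x * y) = scalar_abs x * scalar_abs y.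
Proof. by case: s x y => [x y|x y]; [exact: normrM|exact: Normc.normcM]. Qed.

Lemma scalar_absD x y : scalar_abs (x + y) <= scalar_abs x + scalar_abs y.
Proof. by case: s x y => [x y|x y]; [exact: ler_normD|exact: le_normcD]. Qed.

Lemma scalar_absN x : scalar_abs (- x) = scalar_abs x.
Proof. by case: s x => [x|x]; [exact: normrN|exact: normcN]. Qed.

Lemma scalar_reD x y : scalar_re (x + y) = scalar_re x + scalar_re y.
Proof. by case: s x y => [x y|[a b] [c e]]. Qed.

Lemma scalar_imD x y : scalar_im (x + y) = scalar_im x + scalar_im y.
Proof. by case: s x y => [x y|[a b] [c e]] //=; rewrite addr0. Qed.

Lemma scalar_reN x : scalar_re (- x) = - scalar_re x.
Proof. by case: s x => [x|[a b]]. Qed.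

Lemma scalar_imN x : scalar_im (- x) = - scalar_im x.
Proof. by case: s x => [x|[a b]] //=; rewrite oppr0. Qed.

Lemma scalar_reM x y :
  scalar_re (x * y) = scalar_re x * scalar_re y - scalar_im x * scalar_im y.
Proof. by case: s x y => [x y|[a b] [c e]] //=; rewrite mulr0 subr0. Qed.

Lemma scalar_imM x y :
  scalar_im (x * y) = scalar_re x * scalar_im y + scalar_im x * scalar_re y.
Proof. by case: s x y => [x y|[a b] [c e]] //=; rewrite mulr0 mul0r addr0. Qed.

Lemma scalar_absE x :
  scalar_abs x = Num.sqrt (scalar_re x ^+ 2 + scalar_im x ^+ 2).
Proof. by case: s x => [x|[a b]] //=; rewrite expr0n addr0 sqrtr_sqr. Qed.

Lemma scalar_abs_re x : `|scalar_re x| <= scalar_abs x.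
Proof. by rewrite scalar_absE -sqrtr_sqr ler_wsqrtr// lerDl sqr_ge0. Qed.

Lemma scalar_abs_im x : `|scalar_im x| <= scalar_abs x.
Proof. by rewrite scalar_absE -sqrtr_sqr ler_wsqrtr// lerDr sqr_ge0. Qed.

Lemma scalar_abs_le x : scalar_abs x <= `|scalar_re x| + `|scalar_im x|.
Proof.
rewrite scalar_absE -(@ger0_norm _ (`|_| + `|_|)) ?addr_ge0//.
rewrite -sqrtr_sqr ler_wsqrtr// sqrrD !real_normK ?num_real//.
by rewrite -addrA lerD2l lerDr mulrn_wge0// mulr_ge0.
Qed.

Lemma scalar_open (U : set K) : open U <->
  forall x, U x -> exists2 e : R, 0 < e & forall y, scalar_abs (y - x) < e -> U y.
Proof.
rewrite openE; split => Uo x Ux.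
- have /nbhs_ballP[e /= e0 xeU] := Uo _ Ux.
  case: s U x Uo Ux e e0 xeU => /= U x _ _ e e0 xeU.
    by exists e => // y ye; apply: xeU; rewrite /ball/= distrC.
  case: e e0 xeU => a b; rewrite ltcE/= => /andP[/eqP -> a0] xeU.
  exists a => // y ya; apply: xeU; rewrite /ball/= distrC.
  by rewrite normc_def -/(Normc.normc _) ltcR; case: (y - x) ya.
- have [e e0 xeU] := Uo _ Ux; apply/nbhs_ballP.
  case: s U x {Uo Ux} xeU => /= U x xeU.
    by exists e => //= y; rewrite /ball/= distrC => /xeU.
  exists (e%:C)%C; first by rewrite /= ltcR.
  move=> y; rewrite /ball/= distrC normc_def ltcR => ye.
  by apply: xeU; case: (y - x) ye.
Qed.

Section Measurability.
Context d (Y : measurableType d).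

Lemma measurable_scalar_lip (g : K -> R) :
  (forall x y, `|g y - g x| <= scalar_abs (y - x)) ->
  measurable_fun setT (g : borel K -> R).
Proof.
move=> lip.
apply: (measurability _ (RGenOpens.measurableE R)).
move=> _ [_ [a [b ->]] <-]; rewrite setTI.
apply: sub_sigma_algebra; apply/scalar_open => x /=.
rewrite in_itv/= => /andP[ax xb].
exists (Num.min (g x - a) (b - g x)); first by rewrite lt_min !subr_gt0 ax.
move=> y; rewrite lt_min => /andP[y1 y2].
have := lip x y; rewrite ler_norml => /andP[l1 l2].
rewrite /= in_itv/=; apply/andP; split; first by lra.
by lra.
Qed.

Lemma measurable_scalar_re : measurable_fun setT (@scalar_re R s : borel K -> R).
Proof.
apply: measurable_scalar_lip => x y.
by rewrite -scalar_reN -scalar_reD scalar_abs_re.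
Qed.

Lemma measurable_scalar_im : measurable_fun setT (@scalar_im R s : borel K -> R).
Proof.
apply: measurable_scalar_lip => x y.
by rewrite -scalar_imN -scalar_imD scalar_abs_im.
Qed.

Lemma measurable_scalar_abs :
  measurable_fun setT (@scalar_abs R s : borel K -> R).
Proof.
apply: measurable_scalar_lip => x y; rewrite ler_norml.
have := scalar_absD (y - x) x; rewrite subrK.
have := scalar_absD (x - y) y; rewrite subrK -opprB scalar_absN.
by move=> h1 h2; apply/andP; split; lra.
Qed.

Lemma measurable_scalarP (f : Y -> borel K) : measurable_fun setT f <->
  measurable_fun setT (@scalar_re R s \o f) /\
  measurable_fun setT (@scalar_im R s \o f).
Proof.
split=> [mf|[mre mim]].
  split; first exact: (measurableT_comp measurable_scalar_re mf).
  exact: (measurableT_comp measurable_scalar_im mf).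
apply: (@measurability _ _ _ (borel K) setT f (@open K)) => // _
  [U oU <-]; rewrite setTI.
pose S (q : rat * rat * rat) : set K := [set z |
  `|scalar_re z - ratr q.1.1| < ratr q.2 /\
  `|scalar_im z - ratr q.1.2| < ratr q.2].
have mS q : measurable (f @^-1` S q).
  rewrite (_ : f @^-1` S q =
      ((@scalar_re R s \o f) @^-1` ball (ratr q.1.1 : R) (ratr q.2)) `&`
      ((@scalar_im R s \o f) @^-1` ball (ratr q.1.2 : R) (ratr q.2))); last first.
    apply/seteqP; split => y /=; rewrite /ball/= => -[];
      by rewrite ![`|ratr _ - _|]distrC// ![`|_ - ratr _|]distrC.
  by apply: measurableI; rewrite -[X in measurable X]setTI;
    [apply: mre|apply: mim] => //; apply: open_measurable;
    exact: ball_open.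
rewrite (_ : f @^-1` U = \bigcup_(q in [set q | S q `<=` U]) (f @^-1` S q)).
  rewrite bigcup_mkcond; apply: countable_bigcupT_measurable.
    exact: countableP.
  by move=> q; case: ifP => // _; exact: measurable0.
apply/seteqP; split => y /= => [Uy|[q qU]]; last exact: qU.
have [e e0 eU] := (scalar_open U).1 oU _ Uy.
have e4 : 0 < e / 4 by lra.
have /rat_in_itvoo[c /= /[!in_itv]/= /andP[c0 ce]] := e4.
set x := f y in Uy eU *.
have h (t : R) : exists a : rat, `|t - ratr a| < ratr c.
  have /rat_in_itvoo[a /= /[!in_itv]/= /andP[a1 a2]] : t - ratr c < t + ratr c.
    by lra.
  by exists a; rewrite ltr_norml; apply/andP; split; lra.
have [[a xa] [b xb]] := (h (scalar_re x), h (scalar_im x)).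
exists (a, b, c) => // z /= [za zb]; apply: eU.
rewrite (le_lt_trans (scalar_abs_le _))//.
rewrite scalar_reD scalar_reN scalar_imD scalar_imN.
have := ler_distD (ratr a) (scalar_re z) (scalar_re x).
have := ler_distD (ratr b) (scalar_im z) (scalar_im x).
rewrite [`|ratr a - _|]distrC [`|ratr b - _|]distrC /=.
lra.
Qed.

End Measurability.
End ScalarTheory.

Definition in_Lfun (R : realType) (s : scalars) d (Y : measurableType d)
    (mu : {measure set Y -> \bar R}) (p : R) (f : Y -> scalar_field R s) : Prop :=
  measurable_fun setT (f : Y -> borel (scalar_field R s)) /\
  finite_norm mu p%:E (fun y => scalar_abs (f y)).

Section LfunType.
Context (R : realType) (s : scalars) d (Y : measurableType d).
Variables (mu : {measure set Y -> \bar R}) (p : R) (p1 : 1 <= p).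
Local Notation K := (scalar_field R s).

(* The proof of 1 <= p is a phantom argument, as in the library's LfunType: it
   is what makes the predicate provably closed under linear combinations. *)
Definition Lfun_mem of 1 <= p : {pred Y -> K} := [pred f | `[< in_Lfun mu p f >]].

Lemma Lnorm_abs_le (f g : Y -> R) :
  measurable_fun setT f -> measurable_fun setT g ->
  (forall y, `|f y| <= `|g y|) ->
  ('N[mu]_p%:E[EFin \o f] <= 'N[mu]_p%:E[EFin \o g])%E.
Proof.
move=> mf mg fg; rewrite unlock /Lnorm.
have p0 : 0 < p := lt_le_trans ltr01 p1.
have mpow (h : Y -> R) : measurable_fun setT h ->
    measurable_fun setT (fun y => (`|(h y)%:E| `^ p)%E).
  move=> mh; apply/measurable_EFinP.
  by apply: (measurableT_comp (measurable_powR p)); exact: measurableT_comp.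
apply: gt0_ler_poweR.
- by rewrite invr_ge0 ltW.
- by rewrite in_itv/= leey andbT integral_ge0.
- by rewrite in_itv/= leey andbT integral_ge0.
apply: ge0_le_integral => //;
  [by move=> y _; exact: poweR_ge0|exact: mpow|exact: mpow|].
move=> y _; rewrite /= lee_fin ge0_ler_powR// ?nnegrE// ltW//.
Qed.

Lemma in_Lfun_submod : submod_closed (Lfun_mem p1).
Proof.
have p1E : (1 <= p%:E)%E by rewrite lee_fin.
split.
  apply/asboolP; split; first exact: measurable_cst.
  rewrite /finite_norm (_ : _ \o _ = cst 0%E).
    by rewrite Lnorm0// gt_eqF// lte_fin (lt_le_trans ltr01 p1).
  by apply/funext => y /=; rewrite scalar_abs0.
move=> a f g /asboolP[mf nf] /asboolP[mg ng]; apply/asboolP.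
have [mrf mif] := (measurable_scalarP _).1 mf.
have [mrg mig] := (measurable_scalarP _).1 mg.
have mfg : measurable_fun setT ((a *: f + g : Y -> K) : Y -> borel K).
  apply/measurable_scalarP; split.
    rewrite (_ : _ \o _ = fun y => scalar_re a * scalar_re (f y) -
      scalar_im a * scalar_im (f y) + scalar_re (g y)).
      by apply: measurable_funD => //; apply: measurable_funB;
        apply: measurable_funM => //; exact: measurable_cst.
    by apply/funext => y; rewrite /= -scalar_reM -scalar_reD.
  rewrite (_ : _ \o _ = fun y => scalar_re a * scalar_im (f y) +
    scalar_im a * scalar_re (f y) + scalar_im (g y)).
    by apply: measurable_funD => //; apply: measurable_funD;
      apply: measurable_funM => //; exact: measurable_cst.
  by apply/funext => y; rewrite /= -scalar_imM -scalar_imD.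
split => //.
have mabs (h : Y -> K) : measurable_fun setT (h : Y -> borel K) ->
    measurable_fun setT (fun y => scalar_abs (h y)).
  by move=> mh; exact: (measurableT_comp (@measurable_scalar_abs R s) mh).
have fL : (fun y => scalar_abs (f y)) \in Lfun mu p%:E.
  by rewrite inE/=; apply/andP; split; rewrite inE//; exact: mabs.
have gL : (fun y => scalar_abs (g y)) \in Lfun mu p%:E.
  by rewrite inE/=; apply/andP; split; rewrite inE//; exact: mabs.
have [_ /(_ (scalar_abs a) _ _ fL gL)] := Lfun_submod_closed mu p1E.
rewrite inE/= => /andP[/[!inE]/= mS nS].
apply: le_lt_trans nS; apply: Lnorm_abs_le => //; first exact: mabs.
move=> y; rewrite !ger0_norm ?scalar_abs_ge0//.
  by rewrite (le_trans (scalar_absD _ _))// lerD2r scalar_absM.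
by rewrite addr_ge0 ?mulr_ge0 ?scalar_abs_ge0.
Qed.
HB.instance Definition _ :=
  GRing.isSubmodClosed.Build K (Y -> K) (Lfun_mem p1) in_Lfun_submod.

Record scalar_Lfun := ScalarLfun {
  scalar_Lfun_val :> Y -> K ;
  scalar_LfunP : scalar_Lfun_val \in Lfun_mem p1 }.
HB.instance Definition _ := [isSub for scalar_Lfun_val].
HB.instance Definition _ := [Choice of scalar_Lfun by <:].
HB.instance Definition _ := [SubChoice_isSubLmodule of scalar_Lfun by <:].

Definition Lfun_ae_eq (f g : scalar_Lfun) : bool :=
  `[< {ae mu, forall y, f y = g y} >].

Lemma Lfun_ae_eq_refl : reflexive Lfun_ae_eq.
Proof. by move=> f; apply/asboolP; apply: nearW. Qed.

Lemma Lfun_ae_eq_sym : symmetric Lfun_ae_eq.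
Proof.
suff h f g : Lfun_ae_eq f g -> Lfun_ae_eq g f by move=> f g; apply/idP/idP => /h.
by move=> /asboolP fg; apply/asboolP; apply: filterS fg => y ->.
Qed.

Lemma Lfun_ae_eq_trans : transitive Lfun_ae_eq.
Proof.
move=> g f h /asboolP fg /asboolP gh; apply/asboolP.
by apply: filterS2 fg gh => y -> ->.
Qed.

Canonical Lfun_ae_eq_equiv :=
  EquivRel Lfun_ae_eq Lfun_ae_eq_refl Lfun_ae_eq_sym Lfun_ae_eq_trans.

Local Open Scope quotient_scope.

Definition scalar_Lspace : Type := {eq_quot Lfun_ae_eq}.
HB.instance Definition _ := Choice.on scalar_Lspace.
HB.instance Definition _ := EqQuotient.on scalar_Lspace.

Definition Lclass (f : scalar_Lfun) : scalar_Lspace := \pi_scalar_Lspace f.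

Lemma LclassP (f g : scalar_Lfun) :
  Lclass f = Lclass g <-> {ae mu, forall y, f y = g y}.
Proof. by split=> [/eqmodP/asboolP|fg] //; apply/eqmodP/asboolP. Qed.

Lemma Lclass_repr (u : scalar_Lspace) : Lclass (repr u) = u.
Proof. exact: reprK. Qed.

Lemma repr_Lclass (f : scalar_Lfun) : {ae mu, forall y, repr (Lclass f) y = f y}.
Proof. by apply/LclassP; rewrite Lclass_repr. Qed.

Definition Lspace_add (u v : scalar_Lspace) := Lclass (repr u + repr v).
Definition Lspace_opp (u : scalar_Lspace) := Lclass (- repr u).
Definition Lspace_scale (a : K) (u : scalar_Lspace) := Lclass (a *: repr u).

Lemma LclassD f g : Lspace_add (Lclass f) (Lclass g) = Lclass (f + g).
Proof.
apply/LclassP; apply: filterS2 (repr_Lclass f) (repr_Lclass g) => y.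
by move=> /= fy gy; congr (_ + _).
Qed.

Lemma LclassN f : Lspace_opp (Lclass f) = Lclass (- f).
Proof.
by apply/LclassP; apply: filterS (repr_Lclass f) => y /= fy; congr (- _).
Qed.

Lemma LclassZ a f : Lspace_scale a (Lclass f) = Lclass (a *: f).
Proof.
by apply/LclassP; apply: filterS (repr_Lclass f) => y /= fy; congr (_ * _).
Qed.

Lemma Lclass_ind (P : scalar_Lspace -> Prop) :
  (forall f, P (Lclass f)) -> forall u, P u.
Proof. by move=> Pf u; rewrite -(Lclass_repr u). Qed.

Lemma Lspace_addA : associative Lspace_add.
Proof.
elim/Lclass_ind=> f; elim/Lclass_ind=> g; elim/Lclass_ind=> h.
by rewrite !LclassD addrA.
Qed.

Lemma Lspace_addC : commutative Lspace_add.
Proof. by elim/Lclass_ind=> f; elim/Lclass_ind=> g; rewrite !LclassD addrC. Qed.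

Lemma Lspace_add0 : left_id (Lclass 0) Lspace_add.
Proof. by elim/Lclass_ind=> f; rewrite LclassD add0r. Qed.

Lemma Lspace_addN : left_inverse (Lclass 0) Lspace_opp Lspace_add.
Proof. by elim/Lclass_ind=> f; rewrite LclassN LclassD addNr. Qed.

HB.instance Definition _ := GRing.isZmodule.Build scalar_Lspace
  Lspace_addA Lspace_addC Lspace_add0 Lspace_addN.

Lemma Lspace_scaleA a b u :
  Lspace_scale a (Lspace_scale b u) = Lspace_scale (a * b) u.
Proof. by elim/Lclass_ind: u => f; rewrite !LclassZ scalerA. Qed.

Lemma Lspace_scale1 : left_id 1 Lspace_scale.
Proof. by elim/Lclass_ind=> f; rewrite LclassZ scale1r. Qed.

Lemma Lspace_scaleDr : right_distributive Lspace_scale +%R.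
Proof.
move=> a; elim/Lclass_ind=> f; elim/Lclass_ind=> g.
rewrite -[RHS]/(Lspace_add _ _) -[_ + _]/(Lspace_add _ _).
by rewrite !(LclassD, LclassZ) scalerDr.
Qed.

Lemma Lspace_scaleDl u : {morph Lspace_scale^~ u : a b / a + b}.
Proof.
move=> a b; elim/Lclass_ind: u => f.
by rewrite -[RHS]/(Lspace_add _ _) !LclassZ LclassD scalerDl.
Qed.

HB.instance Definition _ := GRing.Zmodule_isLmodule.Build K scalar_Lspace
  Lspace_scaleA Lspace_scale1 Lspace_scaleDr Lspace_scaleDl.

(* The norm is that of the canonical representative; ae-equal functions have
   the same norm. *)
Definition Lspace_norm (u : scalar_Lspace) : R :=
  fine ('N[mu]_p%:E[EFin \o (fun y => scalar_abs (repr u y))])%E.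

End LfunType.
Arguments scalar_Lfun {R} s {d Y} mu {p} p1.
Arguments scalar_Lspace {R} s {d Y} mu {p} p1.

(* For a > 0 the library's power satisfies 0 `^ a = 0. *)
Definition holder_continuous (R : realType) (s : scalars) (X : metricType R)
    (a L : R) (f : X -> scalar_field R s) : Prop :=
  0 <= L /\ forall x x', scalar_abs (f x - f x') <= L * mdist x x' `^ a.

(* k x y * g y is integrated for the canonical representative of the class g;
   the value does not depend on it when the integrals make sense. *)
Definition integral_operator (R : realType) (s : scalars) (X : Type) d
    (Y : measurableType d) (mu : {measure set Y -> \bar R}) (q : R)
    (q1 : 1 <= q) (k : X -> Y -> scalar_field R s) (g : scalar_Lspace s mu q1) :
    X -> scalar_field R s :=
  fun x => scalar_integral mu (fun y => k x y * repr g y).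

(* Main.v *)
Require Import Defs.
From HB Require Import structures.
From mathcomp Require Import all_boot all_order all_algebra.
From mathcomp Require Import all_classical all_reals all_analysis.
From mathcomp Require Import measurable_realfun complex.
From mathcomp Require Import lra.
Import Order.TTheory GRing.Theory Num.Theory.
Import numFieldNormedType.Exports.

Set Implicit Arguments.
Unset Strict Implicit.
Unset Printing Implicit Defensive.

Local Open Scope classical_set_scope.
Local Open Scope ring_scope.

(** Hoelder continuity of S_k g rests on the pointwise bound
    |k x y - k x' y| <= L y * d(x, x')^alpha, valid for almost all y: multiplied
    by |g y| and integrated, it gives
    |S_k g x - S_k g x'| <= d(x, x')^alpha * \int L |g|
    (lemma [scalar_abs_integral] moves the modulus inside the integral), and the
    last integral is at most the product of the two norms by Hoelder's
    inequality (lemma [Rintegral_hoelder]).  That S_k is well defined on classes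
    and linear follows from the invariance of the integral under almost
    everywhere equality ([ae_eq_scalar_integral]) and from its linearity
    ([scalar_integral_linear]).  The two scalar fields are treated together,
    through real and imaginary parts. *)

(** * Real and imaginary parts of scalars *)

Section ScalarParts.
Context (R : realType) (s : scalars).
Implicit Types z w : scalar_field R s.

Lemma scalar_eq z w :
  scalar_re z = scalar_re w -> scalar_im z = scalar_im w -> z = w.
Proof. by case: s z w => [z w|[a b] [c e]] //= -> ->. Qed.

Lemma scalar_abs_sqr z :
  scalar_abs z ^+ 2 = scalar_re z ^+ 2 + scalar_im z ^+ 2.
Proof. by rewrite scalar_absE sqr_sqrtr// addr_ge0 ?sqr_ge0. Qed.

(** The Cauchy-Schwarz inequality in the plane: the left-hand side is the real
    part of w times the conjugate of z. *)
Lemma scalar_dot_le z w :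
  scalar_re w * scalar_re z + scalar_im w * scalar_im z <=
  scalar_abs w * scalar_abs z.
Proof.
apply: le_trans (ler_norm _) _.
rewrite -ler_sqr ?nnegrE ?mulr_ge0 ?scalar_abs_ge0//.
rewrite real_normK ?num_real// exprMn !scalar_abs_sqr.
have := sqr_ge0 (scalar_re w * scalar_im z - scalar_im w * scalar_re z).
move: (scalar_re w) (scalar_re z) (scalar_im w) (scalar_im z) => a c b e.
by nra.
Qed.

End ScalarParts.

(** * The integral of scalar-valued functions *)

Section ScalarIntegral.
Context (R : realType) (s : scalars) d (Y : measurableType d).
Variable mu : {measure set Y -> \bar R}.
Local Notation K := (scalar_field R s).
Implicit Types f g : Y -> K.

Lemma scalar_re_integral f :
  scalar_re (scalar_integral mu f) = \int[mu]_y scalar_re (f y).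
Proof. by case: s f. Qed.

Lemma scalar_im_integral f :
  scalar_im (scalar_integral mu f) = \int[mu]_y scalar_im (f y).
Proof.
by case: s f => //= f; rewrite Rintegral_cst// mul0r.
Qed.

Lemma measurable_scalar_abs_comp f :
  measurable_fun setT (f : Y -> borel K) ->
  measurable_fun setT (fun y => scalar_abs (f y)).
Proof.
by move=> mf; exact: (measurableT_comp (@measurable_scalar_abs R s) mf).
Qed.

Lemma integrable_scalar_abs f : in_Lfun mu 1 f ->
  mu.-integrable setT (EFin \o (fun y => scalar_abs (f y))).
Proof.
move=> [mf]; rewrite /finite_norm Lnorm1 => nf; apply/integrableP; split => //.
by apply/measurable_EFinP; exact: measurable_scalar_abs_comp.
Qed.

Lemma integrable_scalar_re f : in_Lfun mu 1 f ->
  mu.-integrable setT (EFin \o (fun y => scalar_re (f y))).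
Proof.
move=> f1; apply: le_integrable (integrable_scalar_abs f1) => //.
  apply/measurable_EFinP.
  exact: (measurableT_comp (@measurable_scalar_re R s) f1.1).
move=> y _ /=; rewrite lee_fin (ger0_norm (scalar_abs_ge0 _)).
exact: scalar_abs_re.
Qed.

Lemma integrable_scalar_im f : in_Lfun mu 1 f ->
  mu.-integrable setT (EFin \o (fun y => scalar_im (f y))).
Proof.
move=> f1; apply: le_integrable (integrable_scalar_abs f1) => //.
  apply/measurable_EFinP.
  exact: (measurableT_comp (@measurable_scalar_im R s) f1.1).
move=> y _ /=; rewrite lee_fin (ger0_norm (scalar_abs_ge0 _)).
exact: scalar_abs_im.
Qed.

Lemma in_Lfun1_linear (a : K) f g : in_Lfun mu 1 f -> in_Lfun mu 1 g ->
  in_Lfun mu 1 (fun y => a * f y + g y).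
Proof.
move=> f1 g1; have [_ h] := @in_Lfun_submod R s d Y mu 1 (lexx 1).
by apply/asboolP; apply: (h a f g); apply/asboolP.
Qed.

Lemma ae_eq_Rintegral (u v : Y -> R) :
  measurable_fun setT u -> measurable_fun setT v ->
  {ae mu, forall y, u y = v y} -> \int[mu]_y u y = \int[mu]_y v y.
Proof.
move=> mmu mv uv; rewrite /Rintegral; congr fine.
apply: ae_eq_integral => //; [exact/measurable_EFinP|exact/measurable_EFinP|].
by apply: filterS uv => y /= -> _.
Qed.

Lemma ae_eq_scalar_integral f g :
  measurable_fun setT (f : Y -> borel K) ->
  measurable_fun setT (g : Y -> borel K) ->
  {ae mu, forall y, f y = g y} -> scalar_integral mu f = scalar_integral mu g.
Proof.
move=> /measurable_scalarP[fre fim] /measurable_scalarP[gre gim] fg.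
apply: scalar_eq; rewrite ?scalar_re_integral ?scalar_im_integral;
  by apply: ae_eq_Rintegral => //; apply: filterS fg => y ->.
Qed.

Lemma Rintegral_lincomb (a b : R) (u v : Y -> R) :
  mu.-integrable setT (EFin \o u) -> mu.-integrable setT (EFin \o v) ->
  mu.-integrable setT (EFin \o (fun y => a * u y + b * v y)) /\
  \int[mu]_y (a * u y + b * v y) = a * \int[mu]_y u y + b * \int[mu]_y v y.
Proof.
move=> iu iv.
have iau : mu.-integrable setT (EFin \o (fun y => a * u y)).
  by have := integrableZl measurableT a iu; apply: eq_integrable.
have ibv : mu.-integrable setT (EFin \o (fun y => b * v y)).
  by have := integrableZl measurableT b iv; apply: eq_integrable.
split; first by have := integrableD measurableT iau ibv; apply: eq_integrable.
by rewrite RintegralD// !RintegralZl.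
Qed.

Lemma scalar_integral_linear (a : K) f g : in_Lfun mu 1 f -> in_Lfun mu 1 g ->
  scalar_integral mu (fun y => a * f y + g y) =
  a * scalar_integral mu f + scalar_integral mu g.
Proof.
move=> f1 g1.
have [fre fim] := (integrable_scalar_re f1, integrable_scalar_im f1).
have [gre gim] := (integrable_scalar_re g1, integrable_scalar_im g1).
apply: scalar_eq.
- rewrite scalar_reD scalar_reM !scalar_re_integral scalar_im_integral.
  have [ih] := Rintegral_lincomb (scalar_re a) (- scalar_im a) fre fim.
  rewrite mulNr => <-; rewrite -RintegralD//; apply: eq_Rintegral => y _.
  by rewrite scalar_reD scalar_reM mulNr.
- rewrite scalar_imD scalar_imM !scalar_im_integral scalar_re_integral.
  have [ih <-] := Rintegral_lincomb (scalar_re a) (scalar_im a) fim fre.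
  rewrite -RintegralD//; apply: eq_Rintegral => y _.
  by rewrite scalar_imD scalar_imM.
Qed.

Lemma scalar_abs_integral f : in_Lfun mu 1 f ->
  scalar_abs (scalar_integral mu f) <= \int[mu]_y scalar_abs (f y).
Proof.
move=> f1; set w := scalar_integral mu f.
have [w0|w0] := leP (scalar_abs w) 0.
  by apply: le_trans w0 _; apply: Rintegral_ge0 => y _; exact: scalar_abs_ge0.
(* |w|^2 is the integral of the real part of w-bar f, which |w| |f| dominates. *)
rewrite -(ler_pM2l w0) -expr2 scalar_abs_sqr !expr2.
have [ih] := Rintegral_lincomb (scalar_re w) (scalar_im w)
  (integrable_scalar_re f1) (integrable_scalar_im f1).
rewrite -scalar_re_integral -scalar_im_integral -/w => <-.
have fa := integrable_scalar_abs f1.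
rewrite -RintegralZl//; apply: le_Rintegral => //.
  by have := integrableZl measurableT (scalar_abs w) fa; apply: eq_integrable.
by move=> y _; exact: scalar_dot_le.
Qed.

End ScalarIntegral.

(** * Hoelder's inequality and the integral operator *)

(** Hoelder's inequality for a nonnegative function h that is dominated almost
    everywhere by a multiple of u v: no integrability of h is assumed. *)
Lemma Rintegral_hoelder (R : realType) d (Y : measurableType d)
    (mu : {measure set Y -> \bar R}) (p q c : R) (h u v : Y -> R) :
  0 < p -> 0 < q -> p^-1 + q^-1 = 1 -> 0 <= c ->
  measurable_fun setT h -> (forall y, 0 <= h y) ->
  measurable_fun setT u -> (forall y, 0 <= u y) -> finite_norm mu p%:E u ->
  measurable_fun setT v -> (forall y, 0 <= v y) -> finite_norm mu q%:E v ->
  {ae mu, forall y, h y <= c * (u y * v y)} ->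
  \int[mu]_y h y <=
  fine ('N[mu]_p%:E[EFin \o u])%E * fine ('N[mu]_q%:E[EFin \o v])%E * c.
Proof.
move=> p0 q0 pq c0 mh h0 mmu u0 nu mv v0 nv huv.
have Nu : ('N[mu]_p%:E[EFin \o u] \is a fin_num)%E.
  by rewrite ge0_fin_numE// Lnorm_ge0.
have Nv : ('N[mu]_q%:E[EFin \o v] \is a fin_num)%E.
  by rewrite ge0_fin_numE// Lnorm_ge0.
have muv : measurable_fun setT (EFin \o (fun y => u y * v y)).
  by apply/measurable_EFinP; exact: measurable_funM.
have uv0 y : (0 <= (u y * v y)%:E)%E by rewrite lee_fin mulr_ge0.
have bound : (\int[mu]_y (h y)%:E <=
    c%:E * ('N[mu]_p%:E[EFin \o u] * 'N[mu]_q%:E[EFin \o v]))%E.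
  apply: (@le_trans _ _ (\int[mu]_y (c%:E * (u y * v y)%:E))%E).
    apply: ae_ge0_le_integral => //.
    - by move=> y _; rewrite lee_fin.
    - exact/measurable_EFinP.
    - by move=> y _; rewrite mule_ge0.
    - exact: measurable_funeM.
    - by apply: filterS huv => y hy _; rewrite -EFinM lee_fin.
  rewrite ge0_integralZl//.
  apply: lee_wpmul2l; first by rewrite lee_fin.
  apply: le_trans (hoelder mu mmu mv p0 q0 pq).
  rewrite Lnorm1 le_eqVlt; apply/orP; left; apply/eqP.
  by apply: eq_integral => y _ /=; rewrite ger0_norm// mulr_ge0.
have {bound} : (\int[mu]_y (h y)%:E <= (fine 'N[mu]_p%:E[EFin \o u] *
    fine 'N[mu]_q%:E[EFin \o v] * c)%:E)%E.
  by rewrite mulrC !EFinM !fineK.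
rewrite /Rintegral -lee_fin => hb; rewrite fineK//.
rewrite ge0_fin_numE; first exact: le_lt_trans hb (ltry _).
by apply: integral_ge0 => y _; rewrite lee_fin.
Qed.

Theorem proposition5p3 (R : realType) (s : scalars)
    (d : measure_display) (Y : measurableType d) (mu : {measure set Y -> \bar R})
    (X : metricType R) (p q : R) (p1 : 1 < p) (q1 : 1 < q)
    (pq : p^-1 + q^-1 = 1) (k : X -> Y -> scalar_field R s)
    (k_meas : forall x, measurable_fun setT (k x : Y -> borel (scalar_field R s)))
    (k_int : forall (g : scalar_Lfun s mu (ltW q1)) (x : X),
      in_Lfun mu 1 (fun y => k x y * g y))
    (alpha : R) (alpha0 : 0 < alpha) (L : Y -> R) (L0 : forall y, 0 <= L y)
    (Lp : L \in Lfun mu p%:E)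
    (k_holder : {ae mu, forall y, holder_continuous alpha (L y) (k^~ y)}) :
  [/\ forall (g : scalar_Lfun s mu (ltW q1)) (x : X),
        integral_operator k (Lclass g) x =
        scalar_integral mu (fun y => k x y * g y),
      linear (integral_operator k : scalar_Lspace s mu (ltW q1) ->
                                    (X -> scalar_field R s))
    & forall g : scalar_Lspace s mu (ltW q1),
        holder_continuous alpha
          (fine ('N[mu]_p%:E[EFin \o L])%E * Lspace_norm g)
          (integral_operator k g)].
Proof.
have eqL (g : scalar_Lfun s mu (ltW q1)) x :
    integral_operator k (Lclass g) x =
    scalar_integral mu (fun y => k x y * g y).
  rewrite /integral_operator; apply: ae_eq_scalar_integral.
  - exact: (k_int _ x).1.
  - exact: (k_int _ x).1.
  - by apply: filterS (repr_Lclass g) => y ->.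
split=> //.
- move=> a; elim/Lclass_ind=> f; elim/Lclass_ind=> g; apply/funext => x.
  rewrite -[a *: _]/(Lspace_scale _ _) LclassZ.
  rewrite -[Lclass _ + _]/(Lspace_add _ _) LclassD eqL.
  transitivity (a * integral_operator k (Lclass f) x +
                integral_operator k (Lclass g) x) => //.
  rewrite !eqL -scalar_integral_linear//.
  by congr (scalar_integral mu); apply/funext => y /=; rewrite mulrDr mulrCA.
- move=> g; split.
    by rewrite mulr_ge0// fine_ge0// Lnorm_ge0.
  move=> x x'.
  have incr : integral_operator k g x - integral_operator k g x' =
      scalar_integral mu (fun y => (k x y - k x' y) * repr g y).
    rewrite addrC -mulN1r -scalar_integral_linear; try exact: k_int.
    congr (scalar_integral mu); apply/funext => y.
    by rewrite mulN1r mulrBl addrC.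
  have incr1 : in_Lfun mu 1 (fun y => (k x y - k x' y) * repr g y).
    rewrite (_ : (fun y => _) =
        fun y => -1 * (k x' y * repr g y) + k x y * repr g y).
      by apply: in_Lfun1_linear; exact: k_int.
    by apply/funext => y; rewrite mulN1r mulrBl addrC.
  rewrite incr; apply: le_trans (scalar_abs_integral incr1) _.
  have /asboolP[mg ng] := scalar_LfunP (repr g).
  have [mL nL] : measurable_fun setT L /\ finite_norm mu p%:E L.
    by move: Lp; rewrite inE/= => /andP[]; rewrite !inE.
  apply: (@Rintegral_hoelder _ _ _ mu p q) => //.
  + exact: lt_trans ltr01 p1.
  + exact: lt_trans ltr01 q1.
  + exact: powR_ge0.
  + exact: measurable_scalar_abs_comp incr1.1.
  + by move=> y; exact: scalar_abs_ge0.
  + exact: measurable_scalar_abs_comp mg.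
  + by move=> y; exact: scalar_abs_ge0.
  + apply: filterS k_holder => y [_ /(_ x x') hk].
    by rewrite scalar_absM mulrA ler_wpM2r ?scalar_abs_ge0// mulrC.
Qed.
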